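(* Let $(X,\Sigma,\mu)$ be a $\sigma$-finite complete measure space with decomposition $X=\left(\bigcup_{n\in\mathbb{N}}A_n\right)\cup B$ into atoms $A_n$ and non-atomic part $B$. Let $u\in L^0(\Sigma)$ and let $\Phi_1,\Phi_2,\Phi_3$ be Young functions such that $\Phi_1(xy)\le\Phi_2(x)+\Phi_3(y)$ for all $x,y\ge0$. If $u$ induces a bounded multiplication operator $M_u:L^{\Phi_1}(\Sigma)\to L^{\Phi_2}(\Sigma)$, $M_uf=u\cdot f$, then (i) $u(x)=0$ for $\mu$-almost all $x\in B$; (ii) $\sup_{n\in\mathbb{N}}|u(A_n)|\,\Phi_3^{-1}\!\left(\frac{1}{\mu(A_n)}\right)<\infty$.
   Context: A Young function is a continuous convex function $\Phi:\mathbb{R}\to\mathbb{R}$ such that $\Phi(x)=0$ if and only if $x=0$, $\Phi(-x)=\Phi(x)$, $\lim_{x\to\infty}\Phi(x)/x=\infty$ and $\lim_{x\to\infty}\Phi(x)=\infty$; $\Phi^{-1}$ denotes the inverse of its restriction to $[0,\infty)$. $L^0(\Sigma)$ is the space of $\mu$-a.e. equivalence classes of scalar-valued $\Sigma$-measurable functions on $X$; $\Phi(f)$ means $\Phi(|f|)$. $L^{\Phi}(\Sigma)=\{f\in L^0(\Sigma): \exists k>0,\ \int_X\Phi(kf)\,d\mu<\infty\}$ with norm $\|f\|_\Phi=\inf\{k>0:\int_X\Phi(f/k)\,d\mu\le1\}$. An atom is a set $A\in\Sigma$ with $\mu(A)>0$ such that every measurable $F\subseteq A$ has $\mu(F)=0$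 or $\mu(F)=\mu(A)$. A $\sigma$-finite measure space decomposes uniquely as $X=(\bigcup_nA_n)\cup B$ with $\{A_n\}$ a countable family of pairwise disjoint atoms (each of finite measure) and $B$, disjoint from all $A_n$, containing no atoms. $u(A_n)$ denotes the a.e. constant value of $u$ on $A_n$. *)

(* Defs.v *)
From HB Require Import structures.
From mathcomp Require Import all_boot all_order all_algebra.
From mathcomp Require Import all_classical all_reals all_analysis.
From mathcomp.real_closed Require Import complex.

Set Implicit Arguments.
Unset Strict Implicit.
Unset Printing Implicit Defensive.

Import Order.TTheory GRing.Theory Num.Theory.
Import numFieldTopology.Exports numFieldNormedType.Exports.

Local Open Scope classical_set_scope.
Local Open Scope ring_scope.

Definition young_function (R : realType) (Phi : R -> R) : Prop :=
  [/\ continuous Phi /\ convex_function [set: R] (Phi : R^o -> R),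
      forall x, Phi x = 0 <-> x = 0,
      forall x, Phi (- x) = Phi x,
      Phi x / x @[x --> +oo] --> +oo
    & Phi x @[x --> +oo] --> +oo].

(* The value outside the image of [0, +oo[ under Phi is a dummy: for a Young
   function that image is [0, +oo[. *)
Definition young_inv (R : realType) (Phi : R -> R) : R -> R :=
  'pinv_(fun=> 0) `[0, +oo[%classic Phi.

(* "Scalar-valued" is read as real-valued or complex-valued; everything below
   is stated for both choices of the scalar field. *)
Variant scalar_kind := RealScalars | ComplexScalars.

Definition scalar_field (R : realType) (k : scalar_kind) : numFieldType :=
  match k with
  | RealScalars => R
  | ComplexScalars => R[i]
  end.

(* The modulus with values in R; the library norm on complex R takes its values
   in complex R. *)
Definition modulus (R : realType) (k : scalar_kind) : scalar_field R k -> R :=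
  match k with
  | RealScalars => fun z : R => `|z|
  | ComplexScalars =>
      fun z : R[i] => complex.ComplexField.Normc.normc z
  end.

Section Orlicz.
Context d (T : measurableType d) (R : realType) (k : scalar_kind).
Variable mu : {measure set T -> \bar R}.

(* Functions stand for their mu-a.e. classes: membership in L^Phi, the norm
   and the operator below only depend on the a.e. class. *)
Definition L0 : set (T -> scalar_field R k) :=
  match k return set (T -> scalar_field R k) with
  | RealScalars => [set f | measurable_fun setT (f : T -> R)]
  | ComplexScalars =>
      [set f | measurable_fun setT (fun x => complex.Re (f x : R[i])) /\
               measurable_fun setT (fun x => complex.Im (f x : R[i]))]
  end.

Definition orlicz (Phi : R -> R) : set (T -> scalar_field R k) :=
  [set f | L0 f /\ exists2 c : R, 0 < c &
     (\int[mu]_x (Phi (c * modulus (f x)))%:E < +oo)%E].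

Definition orlicz_norm (Phi : R -> R) (f : T -> scalar_field R k) : R :=
  inf [set c : R | 0 < c /\
     (\int[mu]_x (Phi (modulus (f x) / c))%:E <= 1)%E].

Definition bounded_mult_op (Phi1 Phi2 : R -> R) (u : T -> scalar_field R k) : Prop :=
  (forall f, orlicz Phi1 f -> orlicz Phi2 (u \* f)) /\
  exists C : R, forall f, orlicz Phi1 f ->
    orlicz_norm Phi2 (u \* f) <= C * orlicz_norm Phi1 f.

Definition atom (A : set T) : Prop :=
  [/\ measurable A, (0 < mu A)%E &
      forall F, measurable F -> F `<=` A -> mu F = 0%E \/ mu F = mu A].

(* The set I of indices makes the family of atoms countable: it may be finite,
   or empty when mu is non-atomic. *)
Definition atomic_decomposition (I : set nat) (A : nat -> set T) (B : set T)
    : Prop :=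
  [/\ forall n, I n -> atom (A n) /\ (mu (A n) < +oo)%E,
      trivIset I A,
      measurable B /\ (forall n, I n -> A n `&` B = set0),
      ~ (exists2 F, F `<=` B & atom F)
    & setT = (\bigcup_(n in I) A n) `|` B].

(* A measurable function is a.e. constant on an atom of finite measure, so the
   dummy value 0 of xget is irrelevant there. *)
Definition ae_value (u : T -> scalar_field R k) (A : set T) : scalar_field R k :=
  xget 0 [set c | {ae mu, forall x, A x -> u x = c}].

End Orlicz.

(* Main.v *)
(* Testing M_u on indicators of sets F of positive finite measure on which
   |u| >= del gives del * Phi3^-1(1 / mu F) <= C with C independent of F. Taking
   F = A_n yields (ii). If |u| >= del > 0 on a non-null part of B, halving that
   part repeatedly (it contains no atom) produces such F of arbitrarily small
   measure, and Phi3^-1(1 / mu F) is unbounded, which is absurd; hence (i). *)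
Require Import Defs.
From HB Require Import structures.
From mathcomp Require Import all_boot all_order all_algebra.
From mathcomp Require Import all_classical all_reals all_analysis.
From mathcomp.real_closed Require Import complex.
From mathcomp Require Import measurable_realfun ring lra.
Import Order.TTheory GRing.Theory Num.Theory.
Import numFieldTopology.Exports numFieldNormedType.Exports.
Local Open Scope classical_set_scope.
Local Open Scope ring_scope.

(** * Young functions and their inverses on the half-line *)

Lemma young_conv (R : realType) (Phi : R -> R) (t x y : R) :
  young_function Phi -> 0 <= t -> t <= 1 ->
  Phi (t * x + (1 - t) * y) <= t * Phi x + (1 - t) * Phi y.
Proof.
move=> [[_ cPhi] _ _ _ _] t0 t1.
by have := cPhi (Itv01 t0 t1) x y (in_setT _) (in_setT _).
Qed.

Lemma young_scale (R : realType) (Phi : R -> R) (t x : R) :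
  young_function Phi -> 0 <= t -> t <= 1 -> Phi (t * x) <= t * Phi x.
Proof.
move=> yPhi t0 t1; have := young_conv _ _ _ x 0 yPhi t0 t1.
have [_ Phi0 _ _ _] := yPhi.
by rewrite (Phi0 0).2// !mulr0 !addr0.
Qed.

(** The midpoint of [x] and [- x] is [0], so convexity and evenness give [Phi 0 <= Phi x]. *)
Lemma young_ge0 (R : realType) (Phi : R -> R) (x : R) :
  young_function Phi -> 0 <= Phi x.
Proof.
move=> yPhi; have [_ Phi0 PhiN _ _] := yPhi.
have h0 : 0 <= 2^-1 :> R by rewrite invr_ge0.
have h1 : 2^-1 <= 1 :> R by rewrite invf_le1 // ler1n.
have := young_conv _ _ _ x (- x) yPhi h0 h1.
rewrite PhiN mulrN -mulrBl -mulrDl subrKC mul1r.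
by rewrite (_ : 2^-1 - (1 - 2^-1) = 0) ?mul0r ?(Phi0 0).2//; field.
Qed.

(** Shrinking [y] by the factor [x / y < 1] shrinks [Phi y], which is positive, by at least that
    factor. *)
Lemma young_lt (R : realType) (Phi : R -> R) (x y : R) :
  young_function Phi -> 0 <= x -> x < y -> Phi x < Phi y.
Proof.
move=> yPhi x0 xy; have y0 : 0 < y by exact: le_lt_trans xy.
have t0 : 0 <= x / y by rewrite divr_ge0// ltW.
have t1 : x / y < 1 by rewrite ltr_pdivrMr// mul1r.
have := young_scale _ _ _ y yPhi t0 (ltW t1).
rewrite divfK ?gt_eqF// => /le_lt_trans; apply.
rewrite gtr_pMl// lt_neqAle young_ge0// andbT eq_sym.
have [_ Phi0 _ _ _] := yPhi.
by apply/eqP => /Phi0 /eqP; rewrite gt_eqF.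
Qed.

Lemma young_le (R : realType) (Phi : R -> R) (x y : R) :
  young_function Phi -> 0 <= x -> x <= y -> Phi x <= Phi y.
Proof.
move=> yPhi x0; rewrite le_eqVlt => /predU1P[->//|xy].
exact/ltW/young_lt.
Qed.

Lemma young_invP (R : realType) (Phi : R -> R) (s : R) :
  young_function Phi -> 0 < s ->
  0 < young_inv Phi s /\ Phi (young_inv Phi s) = s.
Proof.
move=> yPhi s0; have [[ctPhi _] Phi0 _ _ Phioo] := yPhi.
have ims : [set Phi x | x in `[0, +oo[ ] s.
  have [M [_ sM]] := (cvgryPge _).1 Phioo s.
  (* [Phi] is at least [s] strictly beyond [M], hence the [+ 1]; the maximum with [0] makes [[0, m]]
     an interval for the intermediate value theorem. *)
  pose m := Num.max 0 (M + 1).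
  have m0 : 0 <= m by rewrite le_max lexx.
  have sm : s <= Phi m by apply: sM; rewrite lt_max ltrDl ltr01 orbT.
  have [||c c0m <-] := @IVT _ Phi 0 m s m0.
  - exact: continuous_subspaceT.
  - rewrite (_ : Phi 0 = 0); last exact/Phi0.
    by rewrite ge_min le_max ltW//= sm orbT.
  by exists c => //; move: c0m; rewrite /= !in_itv/= => /andP[->].
have Phis : Phi (young_inv Phi s) = s by apply: pinvK; rewrite inE.
split=> //.
have : `[0, +oo[%classic (young_inv Phi s).
  apply: (@surjpinv_image_sub _ _ _ _ [set s] Phi) => [_ ->//|].
  by exists s.
rewrite set_itvE/= le_eqVlt => /predU1P[y0|//].
by move: s0; rewrite -Phis (Phi0 _).2 ?ltxx.
Qed.

(** * The modulus, for both scalar fields at once *)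

Section modulus.
Context {R : realType} {k : scalar_kind}.
Implicit Types z w : scalar_field R k.

Lemma modulus_ge0 z : 0 <= modulus z.
Proof.
by case: k z => [|[a b]] /=; [exact: normr_ge0|exact: sqrtr_ge0].
Qed.

Lemma modulusM z w : modulus (z * w) = modulus z * modulus w.
Proof.
by case: k z w => z w; [exact: normrM|exact: Normc.normcM].
Qed.

Lemma modulus_eq0 z : modulus z = 0 -> z = 0.
Proof.
by case: k z => z; [move/eqP; rewrite normr_eq0 => /eqP|exact: Normc.eq0_normc].
Qed.

Lemma modulus0 : modulus (0 : scalar_field R k) = 0.
Proof. by case: k; [exact: normr0|exact: Normc.normc0]. Qed.

Lemma modulus1 : modulus (1 : scalar_field R k) = 1.
Proof. by case: k; [exact: normr1|exact: Normc.normc1]. Qed.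

(** The indicator is scalar-valued on the left and [R]-valued on the right. *)
Lemma modulus_indic {T : Type} (F : set T) (x : T) :
  modulus (\1_F x : scalar_field R k) = \1_F x.
Proof. by rewrite !indicE; case: (x \in F); rewrite (modulus1, modulus0). Qed.

Lemma measurable_modulus d (T : measurableType d) (f : T -> scalar_field R k) :
  L0 f -> measurable_fun setT (fun x => modulus (f x)).
Proof.
case: k f => f /=; first by move=> mf; exact: measurableT_comp.
move=> [mRe mIm].
rewrite (_ : (fun x => _) = Num.sqrt \o
  (fun x => complex.Re (f x : R[i]) ^+ 2 + complex.Im (f x : R[i]) ^+ 2)).
  apply: measurableT_comp.
    by apply: continuous_measurable_fun; exact: sqrt_continuous.
  by apply: measurable_funD; exact: measurable_funX.
by apply/funext => x /=; case: (f x).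
Qed.

Lemma L0_indic d (T : measurableType d) (F : set T) :
  measurable F -> L0 (\1_F : T -> scalar_field R k).
Proof.
case: k => mF /=; first exact: measurable_indic.
split.
  rewrite (_ : (fun x => _) = (\1_F : T -> R)); first exact: measurable_indic.
  by apply/funext => x; rewrite !indicE; case: (x \in F).
rewrite (_ : (fun x => _) = (cst 0 : T -> R)); first exact: measurable_cst.
by apply/funext => x; rewrite !indicE; case: (x \in F).
Qed.

End modulus.

(** * Orlicz norms tested on indicators *)

Section orlicz_indicator.
Context d (T : measurableType d) (R : realType) (k : scalar_kind).
Variable mu : {measure set T -> \bar R}.
Implicit Types (F : set T) (Phi : R -> R) (f : T -> scalar_field R k).

(** Since [Phi 0 = 0], the integrand is [Phi z] times the indicator of [F]. *)
Lemma integral_young_indic Phi F (z : R) :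
  young_function Phi -> measurable F ->
  (\int[mu]_x (Phi (z * \1_F x))%:E = (Phi z)%:E * mu F)%E.
Proof.
move=> yPhi mF; rewrite -[in RHS](setIT F) -integral_indic//.
rewrite -ge0_integralZl_EFin ?young_ge0//; last first.
  exact/measurable_EFinP/measurable_indic.
apply: eq_integral => x _; rewrite indicE -EFinM.
case: (x \in F); rewrite ?mulr1 // !mulr0.
by have [_ Phi0 _ _ _] := yPhi; rewrite (Phi0 0).2.
Qed.

Lemma measurable_young_modulus Phi f (c : R) :
  young_function Phi -> L0 f ->
  measurable_fun setT (fun x => (Phi (c * modulus (f x)))%:E).
Proof.
move=> [[ctPhi _] _ _ _ _] mf; apply/measurable_EFinP.
apply: (measurableT_comp (continuous_measurable_fun ctPhi)).
by apply: measurable_funM => //; exact: measurable_modulus.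
Qed.

Lemma orlicz_indic Phi F :
  young_function Phi -> measurable F -> (mu F < +oo)%E ->
  orlicz mu Phi (\1_F : T -> scalar_field R k).
Proof.
move=> yPhi mF Foo; split; first exact: L0_indic.
exists 1 => //; under eq_integral do rewrite modulus_indic.
by rewrite integral_young_indic// lte_mul_pinfty// ?lee_fin ?young_ge0.
Qed.

Lemma orlicz_norm_ge0 Phi f : 0 <= orlicz_norm mu Phi f.
Proof.
rewrite /orlicz_norm; set S := [set c | _].
(* The infimum of the empty set is [0] by convention. *)
have [->|S0] := eqVneq S set0; first by rewrite inf0.
by apply: lb_le_inf; [exact/set0P|move=> c [/ltW]].
Qed.

(** The constant [z^-1] is itself admissible in the infimum, the integral being
    [Phi z * mu F <= 1]. *)
Lemma orlicz_norm_indic_le Phi F (z : R) :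
  young_function Phi -> measurable F -> (0 < mu F < +oo)%E ->
  0 < z -> Phi z <= (fine (mu F))^-1 ->
  orlicz_norm mu Phi (\1_F : T -> scalar_field R k) <= z^-1.
Proof.
move=> yPhi mF /andP[F0 Foo] z0 zF; apply: ge_inf.
  by exists 0 => c [/ltW].
split; first by rewrite invr_gt0.
under eq_integral do rewrite modulus_indic invrK mulrC.
rewrite integral_young_indic// -(@fineK _ (mu F)) ?ge0_fin_numE// -EFinM lee_fin.
by rewrite -ler_pdivlMr ?mul1r// fine_gt0// F0.
Qed.

(** An admissible [b < del / x] would give [Phi (del / b) > Phi x], so the integral over [F] alone
    would exceed [Phi x * mu F = 1]. *)
Lemma orlicz_norm_ge Phi f F (del x : R) :
  young_function Phi -> orlicz mu Phi f ->
  measurable F -> (0 < mu F < +oo)%E ->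
  0 <= del -> {ae mu, forall t, F t -> del <= modulus (f t)} ->
  0 < x -> Phi x = (fine (mu F))^-1 ->
  del / x <= orlicz_norm mu Phi f.
Proof.
move=> yPhi [mf [c c0 cf]] mF /andP[F0 Foo] del0 aedel x0 xF.
have fF0 : 0 < fine (mu F) by rewrite fine_gt0// F0.
apply: lb_le_inf.
  (* The set of admissible constants must be shown nonempty, lest the infimum be the default [0].
     Scaling by [e = 1 / (1 + J)] brings the integral down to at most [e * J <= 1]. *)
  set J := (\int[mu]_t _)%E in cf.
  have J0 : (0 <= J)%E by apply: integral_ge0 => t _; rewrite lee_fin young_ge0.
  have Jfin : J \is a fin_num by rewrite ge0_fin_numE.
  pose e := (1 + fine J)^-1.
  have e0 : 0 < e by rewrite invr_gt0 ltr_pwDl// fine_ge0.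
  have e1 : e <= 1 by rewrite invf_le1 ?ler_wpDr ?fine_ge0// ltr_pwDl// fine_ge0.
  exists (e * c)^-1; split; first by rewrite invr_gt0 mulr_gt0.
  rewrite invrK; apply: (@le_trans _ _ (e%:E * J)%E).
    rewrite -ge0_integralZl_EFin//; [|by move=> t _; rewrite lee_fin young_ge0
      |exact: measurable_young_modulus|exact: ltW].
    apply: ge0_le_integral => //.
    - by move=> t _; rewrite lee_fin young_ge0.
    - by under eq_fun do rewrite mulrC; exact: measurable_young_modulus.
    - by apply: measurable_funeM; exact: measurable_young_modulus.
    move=> t _; rewrite -EFinM lee_fin mulrC -mulrA young_scale//.
    exact: ltW.
  rewrite -(fineK Jfin) -EFinM lee_fin mulrC ler_pdivrMr.
    by rewrite mul1r lerDr.
  by rewrite ltr_pwDl// fine_ge0.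
move=> b [b0 fb]; rewrite ler_pdivrMr// mulrC -ler_pdivrMr// leNgt.
apply/negP => xdel.
have : ((Phi (del / b))%:E * mu F <= 1)%E.
  rewrite -integral_young_indic//; apply: le_trans fb.
  apply: ae_ge0_le_integral => //.
  - by move=> t _; rewrite lee_fin young_ge0.
  - apply/measurable_EFinP.
    have [[ctPhi _] _ _ _ _] := yPhi.
    apply: (measurableT_comp (continuous_measurable_fun ctPhi)).
    by apply: measurable_funM => //; exact: measurable_indic.
  - by move=> t _; rewrite lee_fin young_ge0.
  - by under eq_fun do rewrite mulrC; exact: measurable_young_modulus.
  apply: filterS aedel => t Ft _; rewrite lee_fin.
  apply: young_le => //; first by rewrite mulr_ge0// divr_ge0// ltW.
  rewrite mulrAC ler_pM2r ?invr_gt0// indicE.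
  have [/set_mem/Ft|_] := boolP (t \in F); first by rewrite mulr1.
  by rewrite mulr0 modulus_ge0.
rewrite -(@fineK _ (mu F)) ?ge0_fin_numE// -EFinM lee_fin -ler_pdivlMr// mul1r.
by rewrite -xF leNgt young_lt// ltW.
Qed.

End orlicz_indicator.

(* Test [M_u] on the indicator of [F] : with [t = 1 / mu F] and [x, y] the
   inverses of [Phi2, Phi3] at [t], one has [Phi1 (x * y / 2) <= t], hence
   [\1_F] has norm at most [2 / (x * y)] while its image has norm at least
   [del / x]. *)
Lemma mult_op_indic_bound d (T : measurableType d) (R : realType)
    (k : scalar_kind) (mu : {measure set T -> \bar R}) (Phi1 Phi2 Phi3 : R -> R)
    (u : T -> scalar_field R k) :
  young_function Phi1 -> young_function Phi2 -> young_function Phi3 ->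
  (forall x y : R, 0 <= x -> 0 <= y -> Phi1 (x * y) <= Phi2 x + Phi3 y) ->
  bounded_mult_op mu Phi1 Phi2 u ->
  exists2 C : R, 0 <= C & forall (F : set T) (del : R),
    measurable F -> (0 < mu F < +oo)%E -> 0 <= del ->
    {ae mu, forall x, F x -> del <= modulus (u x)} ->
    del * young_inv Phi3 (fine (mu F))^-1 <= C.
Proof.
move=> yPhi1 yPhi2 yPhi3 Phi123 [uO [C uC]].
(* The given [C] may be negative, hence the maximum; the [2] compensates the [2^-1] in the test
   constant below. *)
exists (2 * Num.max C 0); first by rewrite mulr_ge0// le_max lexx orbT.
move=> F del mF muF del0 aedel; have /andP[F0 Foo] := muF.
set t := (fine (mu F))^-1.
have t0 : 0 < t by rewrite invr_gt0 fine_gt0// F0.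
have [x0 xt] := young_invP _ _ _ yPhi2 t0.
have [y0 yt] := young_invP _ _ _ yPhi3 t0.
set x := young_inv Phi2 t in x0 xt; set y := young_inv Phi3 t in y0 yt *.
have xy0 : 0 < 2^-1 * (x * y) by rewrite !mulr_gt0// invr_gt0.
have OF : orlicz mu Phi1 (\1_F : T -> scalar_field R k) by exact: orlicz_indic.
have nF : orlicz_norm mu Phi1 (\1_F : T -> scalar_field R k)
    <= (2^-1 * (x * y))^-1.
  apply: orlicz_norm_indic_le => //.
  (* Convexity turns the factor [2^-1] into half of [Phi2 x + Phi3 y = t + t]. *)
  apply: (le_trans (young_scale _ _ _ _ yPhi1 _ _)) => //.
    by rewrite invf_le1// ler1n.
  rewrite -/t mulrC ler_pdivrMr// mulr_natr mulr2n -{1}xt -yt.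
  by apply: Phi123; exact: ltW.
have nuF : del / x <= orlicz_norm mu Phi2 (u \* (\1_F : T -> scalar_field R k)).
  apply: (@orlicz_norm_ge _ _ _ _ _ _ _ F) => //; first exact: uO.
  apply: filterS aedel => a Fa aF /=.
  by rewrite modulusM modulus_indic indicE mem_set// mulr1; exact: Fa.
have : del / x <= Num.max C 0 * (2^-1 * (x * y))^-1.
  apply: (le_trans nuF); apply: (le_trans (uC _ OF)).
  apply: (@le_trans _ _ (Num.max C 0 *
      orlicz_norm mu Phi1 (\1_F : T -> scalar_field R k))).
    by rewrite ler_wpM2r ?orlicz_norm_ge0// le_max lexx.
  by rewrite ler_wpM2l// le_max lexx orbT.
(* The factor [x] cancels, leaving a bound on [del * y] alone. *)
rewrite ler_pdivrMr// => ux.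
rewrite -ler_pdivlMr//; apply: (le_trans ux).
by rewrite le_eqVlt; apply/orP; left; apply/eqP; field; rewrite !gt_eqF.
Qed.

(** Repeated halving: [F] is not an atom, so it splits into two pieces of positive measure, and the
    smaller one has at most half the measure of [F]. *)
Lemma atomless_small_subset d (T : measurableType d) (R : realType)
    (mu : {measure set T -> \bar R}) (E : set T) (n : nat) :
  measurable E -> (0 < mu E < +oo)%E -> (forall F, F `<=` E -> ~ atom mu F) ->
  exists F, [/\ measurable F, F `<=` E, (0 < mu F < +oo)%E &
    fine (mu F) * 2 ^+ n <= fine (mu E)].
Proof.
move=> mE muE Eatom; elim: n => [|n [F [mF FE /andP[F0 Foo] Fn]]].
  by exists E; split => //; rewrite expr0 mulr1.
have [G [mG GF G0 GnF]] : exists G, [/\ measurable G, G `<=` F,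
    mu G <> 0%E & mu G <> mu F].
  apply: contrapT => nG; apply: (Eatom F FE); split => // G mG GF.
  have [->|/eqP G0] := eqVneq (mu G) 0%E; first by left.
  have [->|/eqP GnF] := eqVneq (mu G) (mu F); first by right.
  by exfalso; apply: nG; exists G.
have mFG : measurable (F `\` G) by exact: measurableD.
have FfinG : (mu G < +oo)%E by rewrite (le_lt_trans _ Foo)// le_measure ?inE.
have FfinD : (mu (F `\` G) < +oo)%E.
  by rewrite (le_lt_trans _ Foo)// le_measure ?inE//; exact: subDsetl.
have FE2 : (mu F = mu G + mu (F `\` G))%E.
  rewrite -measureU//; first by rewrite setDUK.
  by rewrite setDE setICA setICr setI0.
have fF : fine (mu F) = fine (mu G) + fine (mu (F `\` G)).
  by rewrite FE2 fineD// ge0_fin_numE.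
have G0' : (0 < mu G)%E by rewrite lt_neqAle measure_ge0 andbT eq_sym; exact/eqP.
have D0 : (0 < mu (F `\` G))%E.
  rewrite lt_neqAle measure_ge0 andbT eq_sym; apply/eqP => D0.
  by apply: GnF; rewrite FE2 D0 adde0.
have [GD|DG] := leP (fine (mu G)) (fine (mu (F `\` G))).
  exists G; split => //; [exact: subset_trans FE|by rewrite G0'|].
  apply: le_trans Fn; rewrite exprS mulrA ler_wpM2r ?exprn_ge0//; lra.
exists (F `\` G); split => //; [by move=> x [/FE]|by rewrite D0|].
apply: le_trans Fn; rewrite exprS mulrA ler_wpM2r ?exprn_ge0//; lra.
Qed.

Theorem theorem2p7 (R : realType) (k : scalar_kind)
    (d : measure_display) (T : measurableType d)
    (mu : {measure set T -> \bar R})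
    (I : set nat) (A : nat -> set T) (B : set T)
    (u : T -> scalar_field R k) (Phi1 Phi2 Phi3 : R -> R) :
  sigma_finite [set: T] mu ->
  measure_is_complete mu ->
  atomic_decomposition mu I A B ->
  L0 u ->
  young_function Phi1 -> young_function Phi2 -> young_function Phi3 ->
  (forall x y : R, 0 <= x -> 0 <= y -> Phi1 (x * y) <= Phi2 x + Phi3 y) ->
  bounded_mult_op mu Phi1 Phi2 u ->
  {ae mu, forall x, B x -> u x = 0} /\
  (ereal_sup [set (modulus (ae_value mu u (A n)) *
                   young_inv Phi3 (fine (mu (A n)))^-1)%:E | n in I]
     < +oo)%E.
Proof.
move=> [S TS mS] _ [Aatom _ [mB _] Batom _] uL0 yPhi1 yPhi2 yPhi3 Phi123 buO.
have [C C0 uC] :=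
  mult_op_indic_bound _ _ _ _ _ _ _ _ _ yPhi1 yPhi2 yPhi3 Phi123 buO.
split; last first.
  apply: (@le_lt_trans _ _ C%:E); last exact: ltry.
  apply: ge_ereal_sup => _ [n In <-]; rewrite lee_fin.
  have [[mA A0 _] Aoo] := Aatom n In.
  (* In the default case of [xget] the product is [0], below [C] because [0 <= C]. *)
  rewrite /ae_value; case: xgetP => [c _ uc|_]; last by rewrite modulus0 mul0r.
  apply: uC => //; [by rewrite A0|exact: modulus_ge0|].
  by apply: filterS uc => x ux /ux ->.
(* The sets [E n] exhaust the part of [B] where [u] is nonzero; cutting with the [S i] makes the
   measures finite. *)
pose E (n : nat) := B `&` [set x | n.+1%:R^-1 <= modulus (u x)].
have mE n : measurable (E n).
  apply: measurableI => //; rewrite -[X in measurable X]setTI.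
  rewrite (_ : [set x | _] = (fun x => modulus (u x)) @^-1` `[n.+1%:R^-1, +oo[).
    by apply: measurable_modulus.
  by apply/seteqP; split=> x /=; rewrite in_itv/= andbT.
have ES0 n i : mu (E n `&` S i) = 0%E.
  apply/eqP; rewrite -measure_le0 leNgt; apply/negP => ES0.
  have [mSi Sioo] := mS i.
  have mES : measurable (E n `&` S i) by exact: measurableI.
  have ESoo : (mu (E n `&` S i) < +oo)%E.
    by rewrite (le_lt_trans _ Sioo)// le_measure ?inE//; exact: subIsetr.
  have ESatom F : F `<=` E n `&` S i -> ~ atom mu F.
    by move=> FES aF; apply: Batom; exists F => // x /FES[[]].
  (* The test bound with [del = n.+1%:R^-1] confines [y] to [C * n.+1%:R], so [M] bounds [1 / mu F]
     from above for every admissible [F]. *)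
  pose e := fine (mu (E n `&` S i)); pose M := Phi3 (C * n.+1%:R).
  have e0 : 0 < e by rewrite fine_gt0// ES0.
  (* Chosen so that [e * M < m < 2 ^+ m], whereas a subset [F] with [mu F * 2 ^+ m <= e] and
     [1 <= M * mu F] forces [2 ^+ m <= e * M]. *)
  pose m := (Num.truncn (e * M)).+1.
  have [|F [mF FES /andP[F0 Foo] Fm]] :=
      atomless_small_subset _ _ _ mu _ m mES _ ESatom.
    by rewrite ES0.
  have fF0 : 0 < fine (mu F) by rewrite fine_gt0// F0.
  have [y0 yF] : 0 < young_inv Phi3 (fine (mu F))^-1 /\
      Phi3 (young_inv Phi3 (fine (mu F))^-1) = (fine (mu F))^-1.
    by apply: young_invP => //; rewrite invr_gt0.
  set y := young_inv _ _ in y0 yF.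
  have yC : y <= C * n.+1%:R.
    rewrite -ler_pdivrMr// mulrC; apply: uC => //; first by rewrite F0.
    by apply: aeW => x /FES[[]].
  have FM : 1 <= M * fine (mu F).
    by rewrite -ler_pdivrMr// mul1r -yF young_le// ltW.
  have M0 : 0 <= M by exact: young_ge0.
  have em : e * M < 2 ^+ m.
    apply: (@lt_trans _ _ m%:R); first exact: truncnS_gt.
    by rewrite -natrX ltr_nat ltn_expl.
  have : 2 ^+ m <= e * M.
    apply: (@le_trans _ _ (fine (mu F) * 2 ^+ m * M)); last exact: ler_wpM2r.
    by rewrite mulrAC ler_peMl ?exprn_ge0// mulrC.
  by rewrite leNgt em.
have negl i n : mu.-negligible (E n `&` S i).
  by exists (E n `&` S i); split => //; apply: measurableI => //; have [] := mS i.
apply: (@negligibleS _ _ _ _ (\bigcup_n \bigcup_i (E n `&` S i))); last first.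
  by apply: negligible_bigcup => n; exact: negligible_bigcup.
move=> x /=; rewrite not_implyE => -[Bx ux0].
have ux : 0 < modulus (u x).
  rewrite lt_neqAle modulus_ge0 andbT eq_sym.
  by apply/eqP => /modulus_eq0.
have [i _ Six] : (\bigcup_i S i) x by rewrite -TS.
(* With [n] the integer part of [1 / |u x|], one has [1 / |u x| < n + 1], which places [x] in
   [E n]. *)
exists (Num.truncn (modulus (u x))^-1) => //; exists i => //; split => //.
split => //=; rewrite invf_ple ?posrE//.
by rewrite ltW// truncnS_gt.
Qed.
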